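(* Let $X$ be a noncompact, metrizable generalized continuum. Then $X$ has at least one end. Furthermore, if $\varepsilon$ is any end of $X$, then there exists a proper embedding $r:[0,\infty)\to X$ such that $r$ points to $\varepsilon$.
   Context: A generalized continuum is a Hausdorff space that is connected, locally connected, $\sigma$-compact, and locally compact. Maps are continuous; a map is proper if preimages of compacta are compact. A subset of $X$ is bounded if its closure in $X$ is compact, and unbounded otherwise. A compact exhaustion of $X$ is a sequence $K_1\subseteq K_2\subseteq\cdots$ of compact subspaces covering $X$ with $K_i\subseteq\mathrm{Int}\,K_{i+1}$ for each $i$; every generalized continuum has one. Given a compact exhaustion $\{K_i\}$ of $X$, an end of $X$ is a sequence $\varepsilon=(W_1,W_2,\ldots)$ with $W_1\supseteq W_2\supseteq\cdots$ and each $W_i$ an unbounded component of $X-K_i$; $E(X)=E(X;\{K_i\})$ is the set of ends (well defined up to canonical bijection under change of exhaustion). A proper map $f:Y\to X$ of generalized continua induces $E(f):E(Y)\to E(X)$: using the compact exhaustion $\{f^{-1}(K_i)\}$ of $Y$, it sends an end $(U_1,U_2,\ldots)$ of $Y$ to $(W_1,W_2,\ldots)$ where $W_i$ is the unique (necessarily unbounded) component of $X-K_i$ containing $f(U_i)$. The space $[0,\infty)$ has exactly one end $\infty$. A proper map $r:[0,\infty)\to X$ points to $\varepsilon\in E(X)$ if $E(r)(\infty)=\varepsilon$. *)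

(* Defs.v *)
From HB Require Import structures.
From mathcomp Require Import all_boot all_order all_algebra.
From mathcomp Require Import all_classical all_reals all_analysis.
Import Order.TTheory GRing.Theory Num.Theory.
Import numFieldTopology.Exports numFieldNormedType.Exports.

Set Implicit Arguments.
Unset Strict Implicit.
Unset Printing Implicit Defensive.

Local Open Scope classical_set_scope.
Local Open Scope ring_scope.

Definition metrizable (R : realType) (X : topologicalType) : Prop :=
  exists d : X -> X -> R,
    [/\ forall x y, 0 <= d x y,
        forall x y, d x y = 0 <-> x = y,
        forall x y, d x y = d y x,
        forall x y z, d x z <= d x y + d y z &
        forall x (U : set X),
          nbhs x U <-> exists2 e : R, 0 < e & [set y | d x y < e] `<=` U].

Definition locally_connected (X : topologicalType) : Prop :=
  forall (x : X) (U : set X), nbhs x U ->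
    exists V : set X, [/\ open V, V x, connected V & V `<=` U].

Definition sigma_compact (X : topologicalType) : Prop :=
  exists C : nat -> set X,
    (forall i, compact (C i)) /\ \bigcup_i C i = [set: X].

Record generalized_continuum (X : topologicalType) : Prop :=
  GeneralizedContinuum {
    gc_hausdorff : hausdorff_space X;
    gc_connected : connected [set: X];
    gc_locally_connected : locally_connected X;
    gc_sigma_compact : sigma_compact X;
    gc_locally_compact : locally_compact [set: X] }.

Definition proper_map (Y X : topologicalType) (f : Y -> X) : Prop :=
  continuous f /\ forall C : set X, compact C -> compact (f @^-1` C).

(* Homeomorphism onto the image, the image having the subspace topology. *)
Definition embedding (Y X : topologicalType) (f : Y -> X) : Prop :=
  [/\ injective f, continuous f &
      forall U : set Y, open U ->
        exists2 V : set X, open V & f @` U = range f `&` V].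

Definition unbounded (X : topologicalType) (A : set X) : Prop :=
  ~ compact (closure A).

Definition components (X : topologicalType) (A : set X) : set (set X) :=
  connected_component A @` A.

Record compact_exhaustion (X : topologicalType) (K : nat -> set X) : Prop :=
  CompactExhaustion {
    exh_compact : forall i, compact (K i);
    exh_subset : forall i, K i `<=` K i.+1;
    exh_interior : forall i, K i `<=` interior (K i.+1);
    exh_cover : \bigcup_i K i = [set: X] }.

(* E(X; K) *)
Definition ends (X : topologicalType) (K : nat -> set X) :
    set (nat -> set X) :=
  [set W | (forall i, W i.+1 `<=` W i) /\
           (forall i, components (~` K i) (W i) /\ unbounded (W i))].

(* E(f) : E(Y; f^-1 K) -> E(X; K); the value at i is the component of X - K i
   containing f (U i), which is unique by ends_map_unique below. *)
Definition ends_map (Y X : topologicalType) (f : Y -> X) (K : nat -> set X)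
    (U : nat -> set Y) : nat -> set X :=
  fun i => xget set0 [set W | components (~` K i) W /\ f @` U i `<=` W].

Definition half_line (R : realType) : topologicalType :=
  set_type ([set` `[0, +oo[%R] : set R).

(* The only element of E([0, oo); L), see ends_half_line below. *)
Definition half_line_end (R : realType) (L : nat -> set (half_line R)) :
    nat -> set (half_line R) :=
  xget (fun=> set0) (ends L).

Definition points_to (R : realType) (X : topologicalType) (K : nat -> set X)
    (r : half_line R -> X) (e : nat -> set X) : Prop :=
  ends_map r K (half_line_end (fun i => r @^-1` K i)) = e.

Lemma compact_nbhs (X : topologicalType) (C : set X) :
  hausdorff_space X -> locally_compact [set: X] -> compact C ->
  exists2 D : set X, compact D & C `<=` interior D.
Proof.
move=> hX lX cC.
have /compact_near_coveringP nC := cC.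
pose G : set_system (set X) :=
  [set P | exists2 D0 : set X, compact D0 &
             forall D, compact D -> D0 `<=` D -> P D].
have FG : Filter G.
  split.
  - by exists set0 => //; exact: compact0.
  - move=> P Q [D1 c1 H1] [D2 c2 H2]; exists (D1 `|` D2).
      exact: compactU.
    by move=> D cD sD; split; [apply: H1|apply: H2] => // x Dx; apply: sD;
      [left|right].
  - by move=> P Q PQ [D1 c1 H1]; exists D1 => // D cD sD; apply/PQ/H1.
suff [D0 cD0 H] : G [set D | C `<=` interior D].
  by exists D0 => //; exact: H.
apply: (nC (set X) G (fun D x => interior D x) FG).
move=> x Cx; have [//|V wV [cV _]] := lX x.
have nV : nbhs x V.
  by move: wV; rewrite /within /=; apply: filterS => y; exact.
exists (interior V, [set D | V `<=` D]).
  split => /=; first exact: nbhs_interior.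
  by exists V.
by move=> [y D] /= [Vy VD]; exact: interiorS Vy.
Qed.

Lemma exists_compact_exhaustion (X : topologicalType) :
  generalized_continuum X -> exists K : nat -> set X, compact_exhaustion K.
Proof.
move=> [hX _ _ [C [cC CT]] lX].
have /choice[F HF] : forall A : set X, exists D : set X,
    compact A -> compact D /\ A `<=` interior D.
  move=> A; have [cA|nA] := pselect (compact A); last by exists set0.
  by have [D cD AD] := compact_nbhs hX lX cA; exists D.
pose K := fix K (n : nat) : set X :=
  if n is m.+1 then F (K m `|` C m) else set0.
have cK i : compact (K i).
  elim: i => [|i IH]; first exact: compact0.
  by have [] := HF _ (compactU IH (cC i)).
have sK i : K i `|` C i `<=` interior (K i.+1).
  by have [] := HF _ (compactU (cK i) (cC i)).
exists K; split => //.
- move=> i x Kx; apply: interior_subset; apply: sK; by left.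
- by move=> i x Kx; apply: sK; left.
- apply/seteqP; split => // x _; have : [set: X] x by [].
  rewrite -CT => -[i _ Cx]; exists i.+1 => //.
  by apply: interior_subset; apply: sK; right.
Qed.

Lemma preimage_exhaustion (Y X : topologicalType) (f : Y -> X)
    (K : nat -> set X) :
  proper_map f -> compact_exhaustion K ->
  compact_exhaustion (fun i => f @^-1` K i).
Proof.
move=> [cf pf] [cK sK iK KT]; split.
- by move=> i; exact: pf.
- by move=> i x; exact: sK.
- by move=> i x /iK; exact: cf.
- by rewrite -preimage_bigcup KT.
Qed.

Section ends_map_theory.
Context (Y X : topologicalType) (f : Y -> X) (K : nat -> set X).
Context (U : nat -> set Y).
Hypothesis cf : continuous f.
Hypothesis EU : ends (fun i => f @^-1` K i) U.

Lemma ends_map_unique i :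
  exists! W, components (~` K i) W /\ f @` U i `<=` W.
Proof.
case: EU => _ /(_ i)[[y /= Ky Uy] _].
have Uyy : U i y by rewrite -Uy; exact: connected_component_refl.
exists (connected_component (~` K i) (f y)); split.
  split; first by exists (f y).
  apply: connected_component_max; first by exists y.
    move=> _ [z Uz <-]; move: Uz; rewrite -Uy.
    exact: connected_component_sub.
  apply: connected_continuous_connected; last exact: continuous_subspaceT.
  by rewrite -Uy; exact: component_connected.
move=> _ [[x Kx <-] s]; apply/esym/same_connected_component/s.
by exists y.
Qed.

Lemma ends_mapP i :
  components (~` K i) (ends_map f K U i) /\ f @` U i `<=` ends_map f K U i.
Proof.
have [W [WP _]] := ends_map_unique i.
exact: (@xgetI _ set0 [set W | components (~` K i) W /\ f @` U i `<=` W] W).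
Qed.

Lemma ends_map_ends :
  hausdorff_space X -> proper_map f -> compact_exhaustion K ->
  ends K (ends_map f K U).
Proof.
move=> hX [_ pf] [_ sK _ _]; split => i.
  have [[x Kx xE] s1] := ends_mapP i.+1.
  have [[x' Kx' xE'] s0] := ends_mapP i.
  case: EU => Udec /(_ i.+1)[[y /= Ky Uy] _].
  have Uyy : U i.+1 y by rewrite -Uy; exact: connected_component_refl.
  have /s1 fy1 : (f @` U i.+1) (f y) by exists y.
  have /s0 fy0 : (f @` U i) (f y) by exists y => //; exact: Udec.
  move: fy0 fy1; rewrite -xE -xE' => fy0 fy1.
  rewrite (same_connected_component fy0).
  apply: connected_component_max => //.
    move=> z /connected_component_sub zK /sK //.
  exact: component_connected.
have [cW s] := ends_mapP i; split => // cclW.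
case: EU => _ /(_ i)[_]; apply.
have cl : closed (f @^-1` closure (ends_map f K U i)).
  by apply: preimage_closed; [move=> x _; exact: cf|exact: closed_closure].
apply: (subclosed_compact _ (pf _ cclW)); first exact: closed_closure.
move/closure_id: (cl) => ->; apply: closureS => y Uy /=.
by apply: subset_closure; apply: s; exists y.
Qed.

End ends_map_theory.

Section half_line_theory.
Context (R : realType).
Local Notation P := (half_line R).

Let v (x : P) : R := set_val x.

Let v_ge0 x : 0 <= v x.
Proof. by have := set_valP x; rewrite /= in_itv/= andbT. Qed.

Let g (t : R) : P.
Proof.
exists (Num.max t 0); apply/mem_set.
by rewrite /= in_itv/= andbT le_max lexx orbT.
Defined.

Let vg t : 0 <= t -> v (g t) = t.
Proof. by move=> t0; rewrite /v set_valE /=; apply/max_idPl. Qed.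

Let gv x : g (v x) = x.
Proof. by apply: val_inj; rewrite -[RHS]/(v x) -[LHS]/(v (g (v x))) vg. Qed.

Let v_cont : continuous v.
Proof. exact: initial_continuous. Qed.

Let g_cont : continuous g.
Proof.
apply: continuous_comp_initial => t.
have -> : set_val \o g = (fun x : R => Num.max x 0).
  by apply/funext => x; rewrite /= set_valE.
by apply: continuous_max; [exact: cvg_id|exact: cvg_cst].
Qed.

Let bounded_compact M : compact [set x : P | v x <= M].
Proof.
have -> : [set x : P | v x <= M] = g @` `[0, M].
  apply/seteqP; split => [x /= xM|_ [t /= + <-]].
    by exists (v x); rewrite ?gv//= in_itv/= v_ge0.
  by rewrite in_itv/= => /andP[t0 tM]; rewrite vg.
apply: continuous_compact; last exact: segment_compact.
exact: continuous_subspaceT.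
Qed.

Let bounded_closed M : closed [set x : P | v x <= M].
Proof.
rewrite (_ : [set x | _] = v @^-1` [set t | t <= M])//.
by apply: preimage_closed; [move=> x _; exact: v_cont|exact: closed_le].
Qed.

Let compact_bd (C : set P) : compact C ->
  exists2 M : R, 0 <= M & forall x, C x -> v x <= M.
Proof.
move=> cC.
have /compact_bounded[M [_ HM]] : compact (v @` C).
  by apply: continuous_compact => //; exact: continuous_subspaceT.
exists (`|M| + 1); first by rewrite addr_ge0.
move=> x Cx; apply: le_trans (ler_norm _) _.
apply: HM; last by exists x.
by rewrite (le_lt_trans (ler_norm _))// ltrDl.
Qed.

Let tail_connected M : 0 <= M -> connected [set x : P | M < v x].
Proof.
move=> M0; have -> : [set x : P | M < v x] = g @` `]M, +oo[.
  apply/seteqP; split => [x /= xM|_ [t /= + <-]].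
    by exists (v x); rewrite ?gv//= in_itv/= andbT.
  by rewrite in_itv/= andbT => Mt; rewrite vg// (le_trans M0)// ltW.
apply: connected_continuous_connected; last exact: continuous_subspaceT.
by apply/connected_intervalP; exact: interval_is_interval.
Qed.

Lemma ends_half_line (L : nat -> set P) :
  compact_exhaustion L -> ends L = [set half_line_end L].
Proof.
move=> [cL sL _ _].
have /choice[M HM] : forall i, exists M : R,
    0 <= M /\ forall x, L i x -> v x <= M.
  by move=> i; have [M M0 HM] := compact_bd (cL i); exists M.
pose W i := connected_component (~` L i) (g (M i + 1)).
have M0 i : 0 <= M i by case: (HM i).
have tailL i : [set x : P | M i < v x] `<=` ~` L i.
  by move=> x /= Mx /(HM i).2; rewrite leNgt Mx.
have tail0 i : [set x : P | M i < v x] (g (M i + 1)).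
  by rewrite /= vg ?ltrDl// addr_ge0.
have tailW i : [set x : P | M i < v x] `<=` W i.
  apply: connected_component_max; [exact: tail0|exact: tailL|].
  exact: tail_connected.
have big i (N : R) : exists x : P, M i < v x /\ N < v x.
  exists (g (Num.max (M i) N + 1)).
  rewrite vg; last by rewrite addr_ge0// le_max M0.
  by split; rewrite ltr_pwDr// le_max lexx ?orbT.
have unbW i : unbounded (W i).
  move=> /compact_bd[N _ HN]; have [x [Mx Nx]] := big i N.
  have /HN : closure (W i) x by apply/subset_closure/tailW.
  by rewrite leNgt Nx.
have EW : ends L W.
  split=> i; last first.
    by split => //; exists (g (M i + 1)) => //; exact: tailL.
  have [x [Mx Mx']] := big i (M i.+1).
  have Wx : W i x by exact: tailW.
  rewrite /W (same_connected_component Wx).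
  apply: connected_component_max; first exact: (tailW i.+1).
    by move=> y /connected_component_sub Ly /sL.
  exact: component_connected.
have uW U : ends L U -> U = W.
  move=> [_ HU]; apply/funext => i; have [[y Ly Uy] ubU] := HU i.
  have [x [Ux Mx]] : exists x, U i x /\ M i < v x.
    apply: contrapT => nx; apply: ubU.
    apply: (subclosed_compact _ (@bounded_compact (M i))).
      exact: closed_closure.
    have /closure_id -> := @bounded_closed (M i).
    apply: closureS => x Ux /=; rewrite leNgt; apply/negP => Mx.
    by apply: nx; exists x.
  move: Ux; rewrite -Uy => /same_connected_component ->.
  exact/esym/same_connected_component/tailW.
have EH : half_line_end L = W by exact: xget_unique.
by rewrite EH; apply/seteqP; split => [U /uW|_ ->].
Qed.

End half_line_theory.

(* Main.v *)
(* An end exists because all but a bounded part of the space lies in finitely many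
   components of the complement of each [K i]; hence an unbounded component can be
   chosen inside the previous one, step by step.

   Given an end [e], points of [e n] and [e n.+1] are joined by a path inside the
   connected open set [e n], obtained by repeatedly refining chains of small
   connected sets. These paths concatenate to a proper path [f] on the half line.
   Cutting out a maximal family of loops of [f] (Zorn) gives a proper path [g]
   whose fibres are intervals. A continuous monotone function [psi] with the same
   fibres as [g] and image the half line then makes [g] factor as [r \o psi], with
   [r] proper and injective, hence a closed embedding. *)
Require Import Defs.
From HB Require Import structures.
From mathcomp Require Import all_boot all_order all_algebra.
From mathcomp Require Import all_classical all_reals all_analysis.
From mathcomp Require Import lra.
Import Order.TTheory GRing.Theory Num.Theory.
Import numFieldTopology.Exports numFieldNormedType.Exports.

Local Open Scope classical_set_scope.
Local Open Scope ring_scope.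

(** * Compactness and components *)

(** If [P Q] failed, the sets [S] with [P (Q]\[S)] would form a proper filter containing [Q]. At a
    cluster point in [Q], a neighbourhood [N] with [P N] puts its own complement into the filter,
    which is absurd. *)
Lemma compact_induction (X : topologicalType) (P : set X -> Prop) (Q : set X) :
  P set0 -> (forall A B, P A -> P B -> P (A `|` B)) ->
  (forall A B, A `<=` B -> P B -> P A) -> compact Q ->
  (forall x, Q x -> exists2 N, nbhs x N & P N) -> P Q.
Proof.
move=> P0 PU PS cQ PN; apply: contrapT => nPQ.
pose F : set_system X := [set S | P (Q `\` S)].
have FF : ProperFilter F.
  split; first by rewrite /F /= setD0.
  split; rewrite /F /=.
  - by rewrite setDT.
  - by move=> S S' PSd PSd'; rewrite /mkset setDE setCI setIUr; exact: PU.
  - by move=> S S' SS'; apply: PS; exact: setDS.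
have [|p [Qp pF]] := cQ F FF; first by rewrite /F /= setDv.
have [N Np PNN] := PN p Qp.
have [] := pF (~` N) N _ Np; last by move=> y [].
by apply: PS PNN => y [Qy /contrapT].
Qed.

Lemma component_open (X : topologicalType) (A : set X) (x : X) :
  locally_connected X -> open A -> open (connected_component A x).
Proof.
move=> lcX oA; rewrite openE => y Cy.
have Ay : A y := connected_component_sub Cy.
have [V [oV Vy cV VA]] := lcX y A (open_nbhs_nbhs (conj oA Ay)).
rewrite (same_connected_component Cy).
by apply: filterS (open_nbhs_nbhs (conj oV Vy)); exact: connected_component_max.
Qed.

Lemma component_meet (X : topologicalType) (A : set X) (x y z : X) :
  connected_component A x z -> connected_component A y z ->
  connected_component A x = connected_component A y.
Proof.
by move=> /same_connected_component -> /same_connected_component ->.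
Qed.

Lemma clopen_setT (X : topologicalType) (C : set X) :
  connected [set: X] -> open C -> closed C -> C !=set0 -> C = setT.
Proof.
by move=> cX oC cC C0; apply: cX => //; exists C => //; rewrite setTI.
Qed.

Section exhaustion.
Context (X : topologicalType) (K : nat -> set X).
Hypotheses (gcX : generalized_continuum X) (exhK : compact_exhaustion K).

Let cK i : compact (K i). Proof. exact: exh_compact. Qed.

Let sK i x : K i x -> K i.+1 x. Proof. exact: exh_subset. Qed.

Let iK i x : K i x -> interior (K i.+1) x. Proof. exact: exh_interior. Qed.

Lemma exhaustion_closed i : closed (K i).
Proof.
by apply: compact_closed => //; exact: gc_hausdorff.
Qed.

Lemma exhaustion_le i j : (i <= j)%N -> K i `<=` K j.
Proof.
move=> /subnK <-; elim: (j - i)%N => // n IH.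
rewrite addSn.
by move=> x /IH /sK.
Qed.

Lemma exhaustion_component_open i x : open (connected_component (~` K i) x).
Proof.
apply: component_open; first exact: (gc_locally_connected gcX).
by rewrite openC; exact: exhaustion_closed.
Qed.

Lemma compact_sub_exhaustion (C : set X) : compact C -> exists i, C `<=` K i.
Proof.
move=> cC; apply: (@compact_induction X (fun S => exists i, S `<=` K i)) => //.
- by exists 0%N.
- move=> A B [i Ai] [j Bj]; exists (maxn i j) => x [/Ai|/Bj];
    by apply: exhaustion_le; rewrite ?leq_maxl ?leq_maxr.
- by move=> A B AB [i Bi]; exists i; exact: subset_trans Bi.
- move=> x _; have : [set: X] x by [].
  rewrite -(exh_cover exhK) => -[i _ Kx]; exists (K i.+1); last by exists i.+1.
  exact: iK.
Qed.

(* A component of [~` K i] reaching beyond [K i.+2] crosses the compact set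
   [K i.+2 `\` interior (K i.+1)]; the point [x0] only serves the case where
   that component is the whole space. *)
Lemma component_crossing i x0 x : ~ K i x0 -> ~ K i.+2 x ->
  (connected_component (~` K i) x `&`
    ((K i.+2 `\` interior (K i.+1)) `|` [set x0])) !=set0.
Proof.
move=> Kx0 Kx; set C := connected_component _ _; apply: contrapT => C0.
have Kix : ~ K i x by move=> /(exhaustion_le _ i.+2)-/(_ (leqW (leqnSn i))).
have Cx : C x by exact: connected_component_refl.
have oC : open C by exact: exhaustion_component_open.
have CK : C `<=` ~` K i.+2.
  have sub : C `<=` interior (K i.+1) `|` ~` K i.+2.
    move=> y Cy; apply: contrapT => /not_orP[nI /contrapT KY].
    by apply: C0; exists y; split => //; left.
  have sep : separated (interior (K i.+1)) (~` K i.+2).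
    split; last first.
      rewrite -subset0 => y [/interior_subset Ky clKy].
      by have [z [/= nKz Kz]] := clKy _ (iK i.+1 y Ky).
    rewrite -subset0 => y [clKy]; apply.
    rewrite (closure_id (K i.+2)).1; last exact: exhaustion_closed.
    by apply: closureS clKy => z /interior_subset; exact: sK.
  have [/(_ _ Cx)/interior_subset/sK//|//] :=
    connected_subset sep sub (@component_connected _ _ _).
have cC : closed C.
  have clK : closure C `<=` ~` K i.
    move=> y clCy Ky; have [z [/CK nKz Kz]] := clCy _ (iK i y Ky).
    by apply: nKz; exact: sK.
  suff CE : closure C = C by rewrite -CE; exact: closed_closure.
  apply/seteqP; split; last exact: subset_closure.
  apply: connected_component_max => //; first exact: subset_closure.
  by apply: connected_closure; exact: component_connected.
have CT : C = setT.
  by apply: clopen_setT => //; [exact: (gc_connected gcX)|exists x].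
by apply: C0; exists x0; split; [rewrite CT|right].
Qed.

(* Otherwise the components of [~` K i] meeting [A] are all bounded, and finitely
   many of them, together with [K i.+2], cover [A]. *)
Lemma unbounded_component (A : set X) i : unbounded A ->
  exists x, [/\ A x, ~ K i x & unbounded (connected_component (~` K i) x)].
Proof.
move=> uA; apply: contrapT => nex.
pose C := connected_component (~` K i).
have bC x : C x `&` A !=set0 -> compact (closure (C x)).
  move=> [y [Cy Ay]]; apply: contrapT => uC; apply: nex; exists y; split => //.
    exact: (connected_component_sub Cy).
  by rewrite /unbounded -(same_connected_component Cy).
(* The components that have a point in [S] and also meet [A]. Compact induction on [S] shows that
   [D Q] has compact closure. *)
pose D (S : set X) := \bigcup_(x in [set x | S x /\ C x `&` A !=set0]) C x.
have hX := gc_hausdorff gcX.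
have [x0 Kx0] : exists x0, ~ K i x0.
  apply: contrapT => nx; apply: uA.
  apply: (subclosed_compact _ (cK i)); first exact: closed_closure.
  by move=> x _; apply: contrapT => Kx; apply: nx; exists x.
pose Q := (K i.+2 `\` interior (K i.+1)) `|` [set x0].
have QK : Q `<=` ~` K i.
  by move=> x [[_ nI] /iK//|->].
have : compact (closure (D Q)).
  apply: (@compact_induction X (fun S => compact (closure (D S)))).
  - rewrite (_ : D set0 = set0) ?closure0; first exact: compact0.
    by rewrite -subset0 => y [x []].
  - move=> S T cS cT; rewrite (_ : D _ = D S `|` D T).
      by rewrite closureU; exact: compactU.
    apply/seteqP; split => [y [x [[Sx|Tx] m] Cy]|y [|] [x [Sx m] Cy]].
    + by left; exists x.
    + by right; exists x.
    + by exists x => //; split => //; left.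
    + by exists x => //; split => //; right.
  - move=> S T ST cT; apply: (subclosed_compact _ cT); first exact: closed_closure.
    by apply: closureS => y [x [/ST Tx m] Cy]; exists x.
  - apply: compactU; last exact: compact_set1.
    apply: compact_closedI; first exact: cK.
    by rewrite closedC; exact: open_interior.
  (* The open component [C x] serves as the neighbourhood: [D (C x)] lies inside it, and is empty
     unless [C x] meets [A]. *)
  - move=> x Qx; have Cx : C x x by apply: connected_component_refl; exact: QK.
    exists (C x); first exact: open_nbhs_nbhs (conj (exhaustion_component_open _ _) Cx).
    have [m|m] := pselect (C x `&` A !=set0).
      apply: (subclosed_compact _ (bC _ m)); first exact: closed_closure.
      apply: closureS => y [z [Cz _]].
      by rewrite /C -(same_connected_component Cz).
    rewrite (_ : D (C x) = set0) ?closure0; first exact: compact0.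
    rewrite -subset0 => y [z [Cz]].
    by rewrite /C -(same_connected_component Cz).
move=> cD; apply: uA.
apply: (subclosed_compact _ (compactU (cK i.+2) cD)).
  exact: closed_closure.
rewrite {1}(closure_id (K i.+2)).1; last exact: exhaustion_closed.
rewrite -closureU; apply: closureS => x Ax.
have [Kx|Kx] := pselect (K i.+2 x); [by left|right].
have Cx : C x x.
  apply: connected_component_refl => Kix; apply: Kx.
  by move: Kix; apply: exhaustion_le; exact: leqW.
have [y [Cy Qy]] := component_crossing i x0 x Kx0 Kx.
have CE := same_connected_component Cy.
exists y; last by rewrite /C -CE.
by split => //; exists x; split => //; rewrite /C -CE.
Qed.

Lemma ends_nonempty : ~ compact [set: X] -> ends K !=set0.
Proof.
move=> ncX.
have uX : unbounded [set: X].
  by rewrite /unbounded -(closure_id _).1//; exact: closedT.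
(* [s] performs one step of the construction: inside an unbounded component at level [i] it picks a
   point whose component at level [i.+1] is again unbounded. *)
have /choice[s sP] : forall p : nat * X, exists y : X,
    unbounded (connected_component (~` K p.1) p.2) ->
    [/\ connected_component (~` K p.1) p.2 y, ~ K p.1.+1 y &
      unbounded (connected_component (~` K p.1.+1) y)].
  move=> [i x]; have [u|nu] := pselect (unbounded (connected_component (~` K i) x)).
    by have [y yP] := unbounded_component _ i.+1 u; exists y.
  by exists x.
have [x0 [_ Kx0 ux0]] := unbounded_component _ 0 uX.
pose x := fix x n := if n is m.+1 then s (m, x m) else x0.
have ux n : ~ K n (x n) /\ unbounded (connected_component (~` K n) (x n)).
  by elim: n => // n [_ u]; have [] := sP (n, x n) u.
exists (fun n => connected_component (~` K n) (x n)); split => n; last first.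
  by have [Kx u] := ux n; split => //; exists (x n).
have [Kx u] := ux n; have [Cy Ky _] := sP (n, x n) u.
rewrite (same_connected_component Cy); apply: connected_component_max.
- exact: connected_component_refl.
- by move=> y /connected_component_sub Ky' /sK.
- exact: component_connected.
Qed.

End exhaustion.

(** * Chains of small connected sets, and paths in connected open sets *)

(** The body of [metrizable] for a given [d], so that one metric can be fixed throughout a
    section. *)
Definition metric_for (R : realType) (X : topologicalType) (d : X -> X -> R) :=
  [/\ forall x y, 0 <= d x y,
      forall x y, d x y = 0 <-> x = y,
      forall x y, d x y = d y x,
      forall x y z, d x z <= d x y + d y z &
      forall x (U : set X),
        nbhs x U <-> exists2 e : R, 0 < e & [set y | d x y < e] `<=` U].

(** Cantor's intersection theorem: points [a n] chosen in [C n] cluster in [C 0], and each closed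
    [C n] contains a tail of the sequence. *)
Lemma nested_compact (X : topologicalType) (C : nat -> set X) :
  compact (C 0%N) -> (forall n, closed (C n)) -> (forall n, C n !=set0) ->
  (forall n, C n.+1 `<=` C n) -> exists p, forall n, C n p.
Proof.
move=> cC clC C0 CS.
have /choice[a Ca] : forall n, exists x, C n x by move=> n; have [x] := C0 n; exists x.
have Cle n m : (n <= m)%N -> C m `<=` C n.
  move=> /subnK <-; elim: (m - n)%N => // k IH.
  by rewrite addSn => x /CS /IH.
have FC n : (a n @[n --> \oo]) (C n).
  by exists n => // m /= nm; exact: Cle nm _ (Ca m).
have [p [_ pF]] := cC (a n @[n --> \oo]) _ (FC 0%N).
exists p => n; rewrite (closure_id (C n)).1// => N Np.
exact: (pF _ _ (FC n) Np).
Qed.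

Section metric.
Context (R : realType) (X : topologicalType) (d : X -> X -> R).
Hypothesis dM : metric_for R X d.

Let d0 x y : 0 <= d x y. Proof. by case: dM. Qed.

Lemma metric_id x : d x x = 0. Proof. by case: dM => _ h _ _ _; exact/h. Qed.

Lemma metric_eq x y : d x y = 0 -> x = y.
Proof. by case: dM => _ h _ _ _ /h. Qed.

Lemma metric_sym x y : d x y = d y x. Proof. by case: dM. Qed.

Lemma metric_triangle y x z : d x z <= d x y + d y z.
Proof. by case: dM. Qed.

Lemma metric_nbhs x e : 0 < e -> nbhs x [set y | d x y < e].
Proof. by move=> e0; case: dM => _ _ _ _ h; apply/h; exists e. Qed.

Lemma metric_nbhsE x U : nbhs x U -> exists2 e : R, 0 < e & [set y | d x y < e] `<=` U.
Proof. by case: dM => _ _ _ _ h /h. Qed.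

Lemma metric_continuous (T : topologicalType) (f : T -> X) t :
  (forall e, 0 < e -> \forall s \near t, d (f t) (f s) < e) ->
  {for t, continuous f}.
Proof.
move=> H U /metric_nbhsE[e e0 eU]; rewrite /= /nbhs /=.
by apply: filterS (H e e0) => s; exact: eU.
Qed.

Lemma metric_eq_lt x y : (forall e, 0 < e -> d x y < e) -> x = y.
Proof.
move=> H; apply: metric_eq; apply/eqP; rewrite eq_le d0 andbT leNgt.
by apply/negP => /H; rewrite ltxx.
Qed.

Lemma closure_metric_le x e (A : set X) y :
  (forall z, A z -> d x z <= e) -> closure A y -> d x y <= e.
Proof.
move=> Ae clA; apply/ler_addgt0Pr => h h0.
have [z [Az /= yz]] := clA _ (metric_nbhs y h h0).
rewrite (le_trans (metric_triangle z x y))// lerD ?Ae// metric_sym ltW//.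
Qed.

Lemma closure_diameter e (A : set X) x y :
  (forall z w, A z -> A w -> d z w <= e) -> closure A x -> closure A y -> d x y <= e.
Proof.
move=> Ae clx cly; apply: closure_metric_le cly => z Az; rewrite metric_sym.
by apply: closure_metric_le clx => w Aw; exact: Ae.
Qed.

Hypotheses (lcX : locally_connected X) (lkX : locally_compact [set: X]).

(** The links of chains. Compact closures make nested links intersect; closures inside [V] keep
    refinements and limit points in [V]. *)
Definition small_in (V : set X) (e : R) (W : set X) :=
  [/\ open W, connected W, compact (closure W), closure W `<=` V &
      forall x y, W x -> W y -> d x y <= e].

Lemma small_in_exists V e x : open V -> V x -> 0 < e ->
  exists2 W, small_in V e W & W x.
Proof.
move=> oV Vx e0; have [C + [cC clC]] := lkX x I.
rewrite withinET => nC.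
have [a a0 aV] := metric_nbhsE x V (open_nbhs_nbhs (conj oV Vx)).
(* Half of [a] keeps even the closure of the ball inside [V]; half of [e] bounds the diameter by
   [e]. *)
pose b := Num.min (a / 2) (e / 2).
have b0 : 0 < b by rewrite lt_min !divr_gt0.
have [W [oW Wx cW WN]] := lcX x _ (filterI nC (metric_nbhs x b b0)).
have Wb y : W y -> d x y < b by case/WN.
exists W => //; split => //.
- apply: (subclosed_compact _ cC); first exact: closed_closure.
  rewrite (closure_id C).1//; apply: closureS => y /WN[].
  by [].
- move=> y clWy; apply: aV; rewrite /= (@le_lt_trans _ _ b)//.
    by apply: closure_metric_le clWy => z /Wb/ltW.
  by rewrite gt_min; apply/orP; left; lra.
- move=> y z /Wb xy /Wb xz.
  have be : b <= e / 2 by rewrite ge_min lexx orbT.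
  have := metric_triangle x y z; rewrite (metric_sym y x); lra.
Qed.

(* Constant after [m] steps, so that the length may be increased at will. *)
Definition chain (V : set X) (e : R) (x y : X) (m : nat)
    (q : nat -> X) (W : nat -> set X) :=
  [/\ q 0%N = x, forall i, (m <= i)%N -> q i = y &
      forall i, [/\ small_in V e (W i), W i (q i) & W i (q i.+1)]].

Lemma chain_refl V e x W : small_in V e W -> W x ->
  chain V e x x 0 (fun=> x) (fun=> W).
Proof. by []. Qed.

Lemma chain_extend V e x y z m q W W1 : chain V e x y m q W ->
  small_in V e W1 -> W1 y -> W1 z ->
  chain V e x z m.+1 (fun i => if (i <= m)%N then q i else z)
    (fun i => if (i < m)%N then W i else W1).
Proof.
move=> [q0 qm qW] sW1 W1y W1z; split => //.
  by move=> i; rewrite ltnNge => /negbTE ->.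
move=> i; have [lt_im|le_mi] := ltnP i m.
  by rewrite (ltnW lt_im); exact: qW.
split => //; case: leqP => // im; rewrite (_ : i = m) ?qm//.
by apply/eqP; rewrite eqn_leq im.
Qed.

(** A small set around a point extends chains both from and to that point, so the set [S] of points
    reachable from [x] is open and closed in the connected set [V]. *)
Lemma chain_exists V e x y : open V -> connected V -> V x -> V y -> 0 < e ->
  exists m q W, chain V e x y m q W.
Proof.
move=> oV cV Vx Vy e0.
pose S := [set z | V z /\ exists m q W, chain V e x z m q W].
have SE z w W1 : S z -> V w -> small_in V e W1 -> W1 z -> W1 w -> S w.
  move=> [Vz [m [q [W c]]]] Vw sW1 W1z W1w; split => //.
  by do 3 eexists; exact: chain_extend c sW1 W1z W1w.
have SV : S `<=` V by move=> z [].
have W1V W1 : small_in V e W1 -> W1 `<=` V.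
  by move=> [_ _ _ h _] z W1z; exact/h/subset_closure.
suff SVE : S = V by have [] : S y by rewrite SVE.
apply: cV.
- have [W sW Wx] := small_in_exists V e x oV Vx e0.
  exists x; split => //; exists 0%N, (fun=> x), (fun=> W); exact: chain_refl.
- exists S; last by apply/esym/setIidPr.
  rewrite openE => z Sz; have Vz := SV _ Sz.
  have [W sW Wz] := small_in_exists V e z oV Vz e0.
  have [oW _ _ _ _] := sW.
  apply: filterS (open_nbhs_nbhs (conj oW Wz)) => w Ww.
  by apply: (SE z w W) => //; exact: W1V sW _ Ww.
- exists (closure S); first exact: closed_closure.
  apply/seteqP; split => [z Sz|z [Vz clz]].
    by split; [exact: SV|exact: subset_closure].
  have [W sW Wz] := small_in_exists V e z oV Vz e0.
  have [oW _ _ _ _] := sW.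
  have [w [Sw Ww]] := clz _ (open_nbhs_nbhs (conj oW Wz)).
  exact: (SE w z W).
Qed.

Lemma nat_bound (N : nat) (f : nat -> nat) : exists m, forall i, (i < N)%N -> (f i <= m)%N.
Proof.
by exists (\max_(i < N) f i) => i iN; exact: (leq_bigmax (Ordinal iN)).
Qed.

(** Each link is itself open and connected, so consecutive points are joined by a finer chain inside
    it. Padding these chains to a common length [m] turns link [i] into the block of indices [j]
    with [j %/ m = i]. *)
Lemma chain_refine U e e' x y N q W : chain U e x y N q W -> 0 < e' ->
  exists m q' W', [/\ (0 < m)%N, chain U e' x y (N * m) q' W' &
    forall i, closure (W' i) `<=` W (i %/ m)%N].
Proof.
move=> [q0 qN qW] e'0.
have oW i : open (W i) by have [[]] := qW i.
have WU i : W i `<=` U.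
  by have [[_ _ _ h _] _ _] := qW i => z Wz; exact/h/subset_closure.
have /choice[c cP] : forall i, exists c : nat * (nat -> X) * (nat -> set X),
    chain (W i) e' (q i) (q i.+1) c.1.1 c.1.2 c.2.
  move=> i; have [[_ cW _ _ _] Wq WqS] := qW i.
  have [m [p [Y h]]] := chain_exists (W i) e' (q i) (q i.+1) (oW i) cW Wq WqS e'0.
  by exists (m, p, Y).
(* [Y] supplies the links after the [N] refined blocks, where the points are constantly [y]. *)
have /choice[Y YP] : forall i, exists Y, small_in (W i) e' Y /\ Y (q i).
  move=> i; have [_ Wq _] := qW i.
  by have [Y sY Yq] := small_in_exists (W i) e' (q i) (oW i) Wq e'0; exists Y.
have [m0 m0P] := nat_bound N (fun i => (c i).1.1).
pose m := m0.+1; have mP i : (i < N)%N -> ((c i).1.1 <= m)%N.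
  by move=> /m0P /leqW.
have m_gt0 : (0 < m)%N by [].
pose q' j := if (j %/ m < N)%N then (c (j %/ m)%N).1.2 (j %% m)%N else y.
pose W' j := if (j %/ m < N)%N then (c (j %/ m)%N).2 (j %% m)%N else Y (j %/ m)%N.
have W'P j : [/\ small_in (W (j %/ m)%N) e' (W' j), W' j (q' j) & W' j (q' j.+1)].
  rewrite /W' /q'; have [jN|Nj] := ltnP (j %/ m) N; last first.
    have [sY Yq] := YP (j %/ m)%N; rewrite qN// in Yq.
    by rewrite ltnNge (leq_trans Nj)//= leq_div2r.
  have [c0 cm cW] := cP (j %/ m)%N; have [sc cj cjS] := cW (j %% m)%N.
  (* At the last index of a block the next point belongs to the following block; the padded chain
     has already reached [q (j %/ m).+1]. *)
  split => //; have [jm|jm] := boolP ((j %% m).+1 == m).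
    have cS : (c (j %/ m)%N).1.2 (j %% m).+1 = q (j %/ m).+1.
      by apply: cm; rewrite (eqP jm) mP.
    have -> : j.+1 = ((j %/ m).+1 * m)%N.
      by rewrite {1}(divn_eq j m) -addnS (eqP jm) mulSn addnC.
    rewrite mulnK// modnMl; case: ltnP => [jN'|Nj'].
      by have [-> _ _] := cP (j %/ m).+1; rewrite -cS.
    by rewrite -(qN _ Nj') -cS.
  have jm' : ((j %% m).+1 < m)%N by rewrite ltn_neqAle jm ltn_pmod.
  have -> : j.+1 = ((j %/ m) * m + (j %% m).+1)%N by rewrite addnS -divn_eq.
  by rewrite divnMDl// modnMDl (divn_small jm') (modn_small jm') addn0 jN.
exists m, q', W'; split => //; last first.
  by move=> j; have [[]] := W'P j.
split.
- rewrite /q' div0n mod0n; case: posnP => [N0|N0]; first by rewrite -q0 qN// N0.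
  by have [-> _ _] := cP 0%N.
- by move=> j Nmj; rewrite /q' ltnNge leq_divRL// Nmj.
- move=> j; have [[? ? ? h ?] ? ?] := W'P j; split => //; split => //.
  by move=> z /h /WU.
Qed.

(** Both sides are at most [n] exactly when [t < n.+1]. This makes the time indices of successive
    stages compatible with the blocks of [chain_refine]. *)
Lemma truncn_mul_div (t : R) m : (0 < m)%N ->
  (Num.truncn (t * m%:R) %/ m = Num.truncn t)%N.
Proof.
move=> m0; have H n : (Num.truncn (t * m%:R) %/ m <= n)%N = (Num.truncn t <= n)%N.
  have nm0 : (0 < n.+1 * m)%N by rewrite muln_gt0.
  rewrite -ltnS ltn_divLR// -(prednK nm0) ltnS !truncn_le_nat prednK// natrM.
  by rewrite ltr_pM2r// ltr0n.
by apply/eqP; rewrite eqn_leq H leqnn -H leqnn.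
Qed.

Lemma truncn_close (s t : R) : s <= t -> t < s + 1 ->
  Num.truncn t = Num.truncn s \/ Num.truncn t = (Num.truncn s).+1.
Proof.
move=> st ts.
have H1 : (Num.truncn s <= Num.truncn t)%N.
  by rewrite truncn_le_nat (le_lt_trans st)// truncnS_gt.
have H2 : (Num.truncn t <= (Num.truncn s).+1)%N.
  have := truncnS_gt s; rewrite truncn_le_nat [in X in _ -> X]mulrSr; lra.
by move: H1; rewrite leq_eqVlt => /orP[/eqP->|H1]; [left|right; apply/eqP; rewrite eqn_leq H2].
Qed.

(* Stage [k] of the refinement splits the time interval into [N k] equal steps;
   [g t] is the point common to the closures of the sets with index
   [truncn (t * N k)] of all stages. *)
Lemma path_exists U x y : open U -> connected U -> U x -> U y ->
  exists g : R -> X, [/\ continuous g, forall t, t <= 0 -> g t = x,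
    forall t, 1 <= t -> g t = y & forall t, U (g t)].
Proof.
move=> oU cU Ux Uy.
pose e k : R := k.+1%:R^-1.
have e0 k : 0 < e k by rewrite invr_gt0.
have e_small h : 0 < h -> exists k, e k < h.
  move=> h0; have [k kP] := ltr_add_invr h0.
  by exists k; rewrite add0r in kP.
pose stage := (nat * (nat -> X) * (nat -> set X))%type.
pose ok k (a : stage) := (0 < a.1.1)%N /\ chain U (e k) x y a.1.1 a.1.2 a.2.
pose refines k (a b : stage) := ok k.+1 b /\ exists m, [/\ (0 < m)%N, b.1.1 = (a.1.1 * m)%N &
    forall i, closure (b.2 i) `<=` a.2 (i %/ m)%N].
have [a0 a0P] : exists a0, ok 0%N a0.
  have [m [q [W [q0 qm qW]]]] := chain_exists U (e 0%N) x y oU cU Ux Uy (e0 0%N).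
  (* One more constant step guarantees a positive number of steps. *)
  exists (m.+1, q, W); split => //; split => //= i mi; apply: qm; exact: ltnW.
have /choice[F FP] : forall p : nat * stage, exists b, (ok p.1 p.2 -> refines p.1 p.2 b).
  move=> [k [[N q] W]]; have [okN|nok] := pselect (ok k (N, q, W)); last by exists a0.
  have [/= N0 c] := okN.
  have [m [q' [W' [m0 c' h]]]] := chain_refine U (e k) (e k.+1) x y N q W c (e0 _).
  exists ((N * m)%N, q', W') => _; split; last by exists m.
  by split => //=; rewrite muln_gt0 N0.
pose a := fix a k := if k is j.+1 then F (j, a j) else a0.
have aok k : ok k (a k).
  by elim: k => // k IH; have [] := FP (k, a k) IH.
have aref k : refines k (a k) (a k.+1) by exact: (FP (k, a k) (aok k)).
pose N k := (a k).1.1; pose q k := (a k).1.2; pose W k := (a k).2.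
have N0 k : (0 < N k)%N by have [] := aok k.
have qP k : [/\ q k 0%N = x, forall i, (N k <= i)%N -> q k i = y &
      forall i, [/\ small_in U (e k) (W k i), W k i (q k i) & W k i (q k i.+1)]].
  by have [] := aok k.
pose ix k (t : R) := Num.truncn (t * (N k)%:R).
have ixS k t : closure (W k.+1 (ix k.+1 t)) `<=` W k (ix k t).
  have [_ [m [m0 Nm h]]] := aref k.
  rewrite /ix (_ : N k.+1 = (N k * m)%N)// natrM mulrA => z /h.
  by rewrite truncn_mul_div.
have /choice[g gP] : forall t, exists p, forall k, closure (W k (ix k t)) p.
  move=> t; apply: nested_compact => [||k|k].
  - by have [_ _ /(_ (ix 0%N t))[[]]] := qP 0%N.
  - by move=> k; exact: closed_closure.
  - have [_ _ /(_ (ix k t))[_ Wq _]] := qP k.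
    by exists (q k (ix k t)); exact: subset_closure.
  - by move=> z /ixS Wz; exact: subset_closure.
have Wd k i z w : closure (W k i) z -> closure (W k i) w -> d z w <= e k.
  move=> clz clw; have [_ _ /(_ i)[[_ _ _ _ h] _ _]] := qP k.
  exact: closure_diameter clz clw.
have Wq k i : closure (W k i) (q k i).
  by apply: subset_closure; have [_ _ /(_ i)[]] := qP k.
have WqS k i : closure (W k i) (q k i.+1).
  by apply: subset_closure; have [_ _ /(_ i)[]] := qP k.
(* Used at the two ends, where every stage has the same point at index [ix k t]. *)
have gq t z : (forall k, q k (ix k t) = z) -> g t = z.
  move=> qz; apply: metric_eq_lt => h /e_small[k ek]; apply: le_lt_trans ek.
  by apply: Wd (gP t k) _; rewrite -(qz k).
(* Times less than one step apart have equal or consecutive indices, and consecutive links share the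
   point [q k (ix k s).+1]. *)
have g_close k s t : s <= t -> t < s + (N k)%:R^-1 -> d (g s) (g t) <= e k + e k.
  move=> st ts; have Nk0 : 0 < (N k)%:R :> R by rewrite ltr0n.
  have [||E|E] := truncn_close (s * (N k)%:R) (t * (N k)%:R).
  - by rewrite ler_pM2r.
  - by rewrite -ltr_pdivlMr// mulrDl mulfK ?gt_eqF// mul1r.
  - rewrite (@le_trans _ _ (e k))//; last by rewrite lerDl ltW.
    by apply: Wd (gP s k) _; rewrite /ix -E; exact: gP.
  - rewrite (le_trans (metric_triangle (q k (ix k s).+1) _ _))// lerD//.
      by apply: Wd (gP s k) _; exact: WqS.
    by apply: Wd (gP t k); rewrite /ix E; exact: Wq.
exists g; split.
- move=> t; apply: metric_continuous => h h0.
  have [k ek] := e_small (h / 2) (divr_gt0 h0 (ltr0Sn _ 1)).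
  have dk0 : 0 < (N k)%:R^-1 :> R by rewrite invr_gt0 ltr0n.
  near=> s.
  have st : `|t - s| < (N k)%:R^-1 by near: s; exact: cvgr_dist_lt.
  apply: (@le_lt_trans _ _ (e k + e k)); last by lra.
  have [le_st|/ltW le_ts] := leP s t.
    by rewrite metric_sym; apply: g_close => //; move: st; rewrite ger0_norm ?subr_ge0//; lra.
  by apply: g_close => //; move: st; rewrite ler0_norm ?subr_le0//; lra.
- move=> t t0; apply: gq => k.
  rewrite (_ : ix k t = 0%N); first by have [] := qP k.
  apply/eqP; rewrite -leqn0 truncn_le_nat (@le_lt_trans _ _ 0)//.
  by rewrite mulr_le0_ge0.
- move=> t t1; apply: gq => k; have [_ + _] := qP k; apply.
  rewrite leqNgt; apply/negP => lt.
  have := truncnS_gt (t * (N k)%:R); rewrite ltNge => /negP; apply.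
  apply: (@le_trans _ _ (N k)%:R); first by rewrite ler_nat.
  by rewrite ler_peMl.
- move=> t; have [_ _ /(_ (ix 0%N t))[[_ _ _ h _] _ _]] := qP 0%N.
  exact/h/gP.
Unshelve. all: by end_near. Qed.

End metric.

(** * Concatenation of paths *)

(** Away from the integers a single piece is followed; at a positive integer [n] the pieces [c n.-1]
    and [c n] both take the value [x n]. Negative times truncate to 0 and stay at [x 0]. *)
Lemma concatenation_continuous (R : realType) (X : topologicalType)
    (c : nat -> R -> X) (x : nat -> X) :
  (forall n, continuous (c n)) -> (forall n t, t <= 0 -> c n t = x n) ->
  (forall n t, 1 <= t -> c n t = x n.+1) ->
  continuous (fun t : R => c (Num.truncn t) (t - (Num.truncn t)%:R)).
Proof.
move=> cc c0 c1 t; set n := Num.truncn t; pose f (s : R) := c (Num.truncn s) (s - (Num.truncn s)%:R).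
have cs m a (s : R) : {for s, continuous (fun s => c m (s - a))}.
  by apply: continuous_comp; [apply: cvgB; [exact: cvg_id|exact: cvg_cst]|exact: cc].
have fE m s : m%:R <= s -> s < m.+1%:R -> f s = c m (s - m%:R).
  by move=> ms sm; rewrite /f (_ : Num.truncn s = m)//; apply: truncn_def; rewrite ms.
have tn : t < n.+1%:R by rewrite truncnS_gt.
change ({for t, continuous f}).
have [t0|t0] := ltP t 0.
  have fc s : s < 0 -> f s = c 0%N 0.
    move=> s0; rewrite /f (_ : Num.truncn s = 0%N) ?c0 ?subr0 ?(ltW s0)//.
    by apply/eqP; rewrite -leqn0 truncn_le_nat (lt_trans s0).
  move=> U /=; rewrite fc// => U0; change (\forall s \near t, U (f s)); near=> s.
  have s0 : s < 0 by near: s; exact: lt_nbhsl.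
  rewrite fc//; exact: nbhs_singleton.
have nt : n%:R <= t by have /andP[] := truncn_itv t0.
have [t_eq|t_neq] := eqVneq t n%:R; last first.
  have lt_nt : n%:R < t by rewrite lt_neqAle eq_sym t_neq.
  move=> U; rewrite (fE n)// => /(cs n n%:R t) cU; change (\forall s \near t, U (f s)); near=> s.
  rewrite (fE n).
  - by near: s; exact: cU.
  - by apply/ltW; near: s; exact: lt_nbhsr.
  - by near: s; exact: lt_nbhsl.
have ft : f t = x n by rewrite (fE n)// c0// t_eq subrr.
have [n0|n_gt0] := posnP n.
  move=> U; rewrite ft n0 => Ux; change (\forall s \near t, U (f s)); near=> s.
  have s1 : s < 1%:R by near: s; apply: lt_nbhsl; rewrite t_eq n0.
  have [s0|s0] := leP 0 s.
    rewrite (fE 0%N)//; near: s; apply: (cs 0%N 0%:R t).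
    by rewrite /= c0// t_eq n0 subrr.
  rewrite /f (_ : Num.truncn s = 0%N) ?c0 ?subr0 ?(ltW s0)//.
    exact: nbhs_singleton.
  by apply/eqP; rewrite -leqn0 truncn_le_nat (lt_trans s0).
have nS : n = n.-1.+1 by rewrite prednK.
move=> U; rewrite ft => Ux; change (\forall s \near t, U (f s)); near=> s.
have sn : s < n.+1%:R by near: s; exact: lt_nbhsl.
have [le_ns|lt_sn] := leP n%:R s.
  rewrite (fE n)//; near: s; apply: (cs n n%:R t).
  by rewrite /= c0// t_eq subrr.
rewrite (fE n.-1) -?nS//; last first.
  by apply/ltW; near: s; apply: lt_nbhsr; rewrite t_eq ltr_nat prednK.
near: s; apply: (cs n.-1 n.-1%:R t).
have t1 : t - n.-1%:R = 1 by rewrite t_eq {1}nS mulrSr addrAC subrr add0r.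
by rewrite /= t1 c1// -nS.
Unshelve. all: by end_near. Qed.

(** * Erasing loops from a path *)

Section loop_erasure.
Context (R : realType) (X : topologicalType) (d : X -> X -> R).
Hypothesis dM : metric_for R X d.
Context (f : R -> X).
Hypotheses (cf : continuous f)
  (f_proper : forall M, exists M', forall s t, 0 <= s <= M -> M' <= t -> f s <> f t).

(** Says that []a, b[] is the component of [V] around [t] and that [f] closes up to a loop on it. *)
Definition gap (V : set R) (t a b : R) :=
  [/\ 0 <= a, a < t < b, ~ V a /\ ~ V b, forall u, a < u < b -> V u & f a = f b].

(** Such a [V] is a disjoint union of open intervals, each of them spanning a loop of [f]. *)
Definition erasable (V : set R) := forall t, V t -> exists a b, gap V t a b.

Lemma gap_le V V' t a b a' b' : V `<=` V' -> gap V t a b -> gap V' t a' b' ->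
  a' <= a /\ b <= b'.
Proof.
move=> OO' [_ /andP[at_ tb] _ hO _] [_ /andP[a't tb'] [na' nb'] _ _].
split; rewrite leNgt; apply/negP => lt.
  by apply: na'; apply/OO'/hO; rewrite lt (lt_trans a't tb).
by apply: nb'; apply/OO'/hO; rewrite lt (lt_trans at_ tb').
Qed.

(** The chain condition for Zorn's lemma. The gaps around [t] in members of the chain grow with the
    member, and their union []inf A, sup B[] is the gap in the union of the chain. *)
Lemma erasable_bigcup (F : set (set R)) : F `<=` erasable -> total_on F subset ->
  erasable (\bigcup_(V in F) V).
Proof.
move=> FE FT t [V0 FO0 O0t]; set U := \bigcup_(V in F) V.
pose G V a b := F V /\ gap V t a b.
have Gex V : F V -> V t -> exists a b, G V a b.
  by move=> FO /(FE V FO)[a [b g]]; exists a, b.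
have Gdir V1 a1 b1 V2 : G V1 a1 b1 -> F V2 ->
    exists V a b, [/\ G V a b, V1 `<=` V, V2 `<=` V, a <= a1 & b1 <= b].
  move=> [FO1 g1] FO2.
  have O1t : V1 t by case: g1 => _ h _ + _; apply.
  have [V12|V21] := FT V1 V2 FO1 FO2.
    have [a [b [_ g]]] := Gex V2 FO2 (V12 _ O1t).
    have [aa1 b1b] := gap_le _ _ _ _ _ _ _ V12 g1 g.
    by exists V2, a, b; split => //; exact: (conj FO2 g).
  by exists V1, a1, b1; split => //; exact: (conj FO1 g1).
have Gdir2 V1 a1 b1 V2 a2 b2 : G V1 a1 b1 -> G V2 a2 b2 ->
    exists V a b, [/\ G V a b, V2 `<=` V, a <= a1, b1 <= b & b2 <= b].
  move=> G1 G2; have [V [a [b [GO O1O O2O aa1 b1b]]]] := Gdir _ _ _ _ G1 G2.1.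
  exists V, a, b; have [aa2 b2b] := gap_le _ _ _ _ _ _ _ O2O G2.2 GO.2.
  by [].
have [a0 [b0 G0]] := Gex V0 FO0 O0t.
pose A := [set a | exists V b, G V a b]; pose B := [set b | exists V a, G V a b].
have hA : has_inf A.
  split; first by exists a0, V0, b0.
  by exists 0 => a [V [b [_ []]]].
(* The left end of a gap lies in [[0, t]], so by [f_proper] the right end, having the same image,
   comes before [M']. *)
have hB : has_sup B.
  split; first by exists b0, V0, a0.
  have [M' HM'] := f_proper t; exists M' => b [V [a [_ [a0' /andP[at_ tb] _ _ fab]]]].
  rewrite leNgt; apply/negP => /ltW M'b; apply: (HM' a b _ M'b fab).
  by rewrite a0' ltW.
pose a := inf A; pose b := sup B.
have aP V a1 b1 : G V a1 b1 -> a <= a1.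
  by move=> g; apply: ge_inf; [exact: hA.2|exists V, b1].
have bP V a1 b1 : G V a1 b1 -> b1 <= b.
  by move=> g; apply: ub_le_sup; [exact: hB.2|exists V, a1].
have approx u v : a < u -> v < b -> exists V a1 b1, [/\ G V a1 b1, a1 < u & v < b1].
  move=> /(inf_lt hA.1)[a1 [V1 [b1 G1]] a1u] /(sup_gt hB.1)[b2 [V2 [a2 G2]] vb2].
  have [V [a3 [b3 [GO _ a31 _ b23]]]] := Gdir2 _ _ _ _ _ _ G1 G2.
  by exists V, a3, b3; split => //; [exact: le_lt_trans a1u|exact: lt_le_trans b23].
have [_ /andP[a0t tb0] _ _ _] := G0.2.
have lt_at : a < t by exact: le_lt_trans (aP _ _ _ G0) a0t.
have lt_tb : t < b by exact: lt_le_trans (bP _ _ _ G0).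
(* If a member contained [a], a larger one would have a gap []c, e[] around [a]. Gaps around [t]
   with left end close enough to [a] would then begin inside []c, e[], hence inside their own
   member. *)
have nUa : ~ U a.
  move=> [V' FO' V'a]; have [V1 [a1 [b1 [G1 _ V'V1 _ _]]]] := Gdir _ _ _ _ G0 FO'.
  have [c [e [_ /andP[ca ae] _ hce _]]] := FE _ G1.1 _ (V'V1 _ V'a).
  have [V2 [a2 [b2 [G2 a2e _]]]] := approx e t ae lt_tb.
  have [V3 [a3 [b3 [G3 V13 a32 _ _]]]] := Gdir2 _ _ _ _ _ _ G2 G1.
  have [_ _ [+ _] _ _] := G3.2; apply; apply/V13/hce.
  by rewrite (lt_le_trans ca (aP _ _ _ G3)) (le_lt_trans a32).
have nUb : ~ U b.
  move=> [V' FO' V'b]; have [V1 [a1 [b1 [G1 _ V'V1 _ _]]]] := Gdir _ _ _ _ G0 FO'.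
  have [c [e [_ /andP[cb be] _ hce _]]] := FE _ G1.1 _ (V'V1 _ V'b).
  have [V2 [a2 [b2 [G2 _ cb2]]]] := approx t c lt_at cb.
  have [V3 [a3 [b3 [G3 V13 _ b23 _]]]] := Gdir2 _ _ _ _ _ _ G2 G1.
  have [_ _ [_ +] _ _] := G3.2; apply; apply/V13/hce.
  by rewrite (le_lt_trans (bP _ _ _ G3) be) (lt_le_trans cb2).
exists a, b; split => //.
- by apply: lb_le_inf; [exact: hA.1|move=> a1 [V [b1 [_ []]]]].
- by rewrite lt_at.
- move=> u /andP[au ub]; have [V [a1 [b1 [GO a1u ub1]]]] := approx u u au ub.
  by exists V; [exact: GO.1|have [_ _ _ + _] := GO.2; apply; rewrite a1u].
(* By continuity: some gap has ends near [a] and [b], and these ends have equal images. *)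
- apply: (metric_eq_lt _ _ _ dM) => h h0.
  have h20 : 0 < h / 2 by exact: divr_gt0.
  have near_f s : exists2 e, 0 < e & forall u, `|s - u| < e -> d (f s) (f u) < h / 2.
    have [e /= e0 eP] : \forall u \near s, d (f s) (f u) < h / 2.
      exact: (cf s _ (metric_nbhs _ _ _ dM (f s) _ h20)).
    by exists e.
  have [ea ea0 Ha] := near_f a; have [eb eb0 Hb] := near_f b.
  have [V [a1 [b1 [GO a1e b1e]]]] : exists V a1 b1,
      [/\ G V a1 b1, a1 < a + ea & b - eb < b1].
    by apply: approx; lra.
  have da : d (f a) (f a1) < h / 2.
    by apply: Ha; rewrite ler0_norm ?subr_le0 ?(aP _ _ _ GO)//; lra.
  have db : d (f b) (f b1) < h / 2.
    by apply: Hb; rewrite ger0_norm ?subr_ge0 ?(bP _ _ _ GO)//; lra.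
  have [_ _ _ _ fab] := GO.2.
  have := metric_triangle _ _ _ dM (f a1) (f a) (f b).
  rewrite [in d (f a1) _]fab (metric_sym _ _ _ dM (f b1) (f b)); lra.
Qed.

(* Cutting out a maximal union of loops leaves a path whose fibres are intervals. *)
Lemma loop_erasure : exists g : R -> X, [/\ continuous g,
  forall s t u, 0 <= s -> s <= u <= t -> g s = g t -> g u = g s &
  forall t, exists2 u, t <= u & g t = f u].
Proof.
have [V [EO maxO]] := Zorn_bigcup erasable_bigcup.
(* Maximality: otherwise adding []s, t[] to [V] would give a larger erasable set. Old gaps contain
   neither [s] nor [t], so each is absorbed by []s, t[] or disjoint from it. *)
have loop s t u : 0 <= s -> ~ V s -> ~ V t -> f s = f t -> s < u < t -> V u.
  move=> s0 ns nt fst /andP[su ut]; apply: contrapT => nu.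
  apply: (maxO (V `|` [set u | s < u < t])).
    split; first by left.
    by move=> /(_ u) h; apply: nu; apply: h; right; rewrite /= su.
  move=> v [Ov|/= stv]; last first.
    exists s, t; split => //.
      by split => -[//|/=]; rewrite ltxx ?andbF.
    by move=> w; right.
  have [a [b [a0 /andP[av vb] [na nb] hab fab]]] := EO v Ov.
  have sout : ~~ (a < s < b) by apply/negP => /hab.
  have tout : ~~ (a < t < b) by apply/negP => /hab.
  have [/andP[sv vt]|vout] := boolP (s < v < t).
    exists s, t; split => //; first by rewrite sv.
      by split => -[//|/=]; rewrite ltxx ?andbF.
    by move=> w; right.
  have vs : v != s by apply/eqP => E; rewrite E in Ov.
  have vt : v != t by apply/eqP => E; rewrite E in Ov.
  have st := lt_trans su ut.
  exists a, b; split; [by []|by rewrite av| |by move=> w /hab; left|by []].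
  by split => -[//|/= /andP[? ?]]; lra.
(* [p t] holds the ends of the gap around [t], or [(t, t)] outside [V]. The new path [f (a t)]
   stands still on every gap. *)
have /choice[p pP] : forall t, exists p : R * R,
    (V t -> gap V t p.1 p.2) /\ (~ V t -> p = (t, t)).
  move=> t; have [Ot|nOt] := pselect (V t); last by exists (t, t).
  by have [a [b g]] := EO t Ot; exists (a, b).
pose a t := (p t).1; pose b t := (p t).2.
have abP t : [/\ ~ V (a t), ~ V (b t), a t <= t <= b t & f (a t) = f (b t)].
  have [Ot|nOt] := pselect (V t).
    by have [_ /andP[/ltW -> /ltW ->] []] := (pP t).1 Ot.
  by rewrite /a /b ((pP t).2 nOt)/= lexx.
have abO t u : ~ V u -> u <= a t \/ b t <= u.
  move=> nu; have [Ot|nOt] := pselect (V t).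
    have [_ _ _ h _] := (pP t).1 Ot.
    have [ua|au] := leP u (a t); [by left|right].
    by rewrite leNgt; apply/negP => ub; apply/nu/h; rewrite au.
  by rewrite /a /b ((pP t).2 nOt)/=; apply/orP; exact: le_total.
have a0 t : 0 <= t -> 0 <= a t.
  move=> t0; have [Ot|nOt] := pselect (V t).
    by have [] := (pP t).1 Ot.
  by rewrite /a ((pP t).2 nOt).
have a_max t u : ~ V u -> u <= t -> u <= a t.
  have [_ _ /andP[_ tb] _] := abP t.
  move=> nu ut; have [//|bu] := abO t u nu.
  have ? : b t = u by lra.
  have ? : t = u by lra.
  have nOt : ~ V t by congr (~ V _): nu.
  by rewrite /a ((pP t).2 nOt).
have a_mono s t : s <= t -> a s <= a t.
  move=> st; have [na _ /andP[le_a _] _] := abP s.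
  by apply: a_max => //; exact: le_trans st.
(* Either [s] and [t] give the same point, or [s <= b s <= a t <= t] with [f (b s)] and [f (a t)]
   the two values; continuity of the new path follows from that of [f]. *)
have gE s t : s <= t -> a s = a t \/ (b s <= a t).
  move=> st; have [na _ _ _] := abP t.
  have [ts|] := abO s (a t) na; last by right.
  by left; apply/eqP; rewrite eq_le ts a_mono.
pose g t := f (a t); exists g; split.
- move=> t; apply: (metric_continuous _ _ _ dM) => h h0.
  have [e /= e0 eP] : \forall u \near t, d (f t) (f u) < h / 2.
    exact: (cf t _ (metric_nbhs _ _ _ dM (f t) _ (divr_gt0 h0 (ltr0Sn _ 1)))).
  have ball u v : `|t - u| < e -> `|t - v| < e -> d (f u) (f v) < h.
    move=> /eP/= tu /eP/= tv; have := metric_triangle _ _ _ dM (f t) (f u) (f v).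
    rewrite (metric_sym _ _ _ dM (f u) (f t)); lra.
  exists e => // s /= ts; have [st|/ltW st] := leP s t.
    have [E|bsat] := gE s t st; first by rewrite /g E (metric_id _ _ _ dM).
    have [_ _ /andP[_ sb] fs] := abP s; have [_ _ /andP[ta _] _] := abP t.
    rewrite ger0_norm ?subr_ge0// in ts; rewrite /g fs.
    by apply: ball; rewrite ger0_norm; lra.
  have [E|bsat] := gE t s st; first by rewrite /g E (metric_id _ _ _ dM).
  have [_ _ /andP[_ sb] fs] := abP t; have [_ _ /andP[ta _] _] := abP s.
  rewrite ler0_norm ?subr_le0// in ts; rewrite /g fs.
  by apply: ball; rewrite ler0_norm; lra.
- move=> s t u s0 /andP[su ut] gst.
  have [ns _ _ _] := abP s; have [nt _ _ _] := abP t; have [nu _ _ _] := abP u.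
  have := a_mono _ _ su; rewrite le_eqVlt => /orP[/eqP E|su']; first by rewrite /g E.
  have := a_mono _ _ ut; rewrite le_eqVlt => /orP[/eqP E|ut']; first by rewrite gst /g E.
  (* Here [a s < a u < a t], so [loop] would put [a u] into [V]. *)
  case: nu; apply: (loop (a s) (a t)) => //; first exact: a0.
  by rewrite su'.
- by move=> t; have [_ _ /andP[_ tb] ab] := abP t; exists (b t).
Qed.

End loop_erasure.

(** * Sums with weights [2^-(p+1)] *)

Section half_series.
Context (R : realType).
Implicit Types c : nat -> R.

Definition half_sum c : R := limn (series (fun p => c p * (2^-1) ^+ p.+1)).

Let bounded01 c := forall p, 0 <= c p <= 1.

Let w0 p : 0 < (2^-1) ^+ p.+1 :> R.
Proof. by rewrite exprn_gt0// invr_gt0. Qed.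

Let cvg_geo : series (fun p => (2^-1) ^+ p.+1 : R) @ \oo --> (1 : R).
Proof.
have E : (fun p => (2^-1) ^+ p.+1 : R) = geometric (2^-1) (2^-1).
  by apply/funext => p; rewrite /geometric /= exprS.
rewrite E [X in _ --> X](_ : 1 = 2^-1 / (1 - 2^-1 : R)); last first.
  by rewrite (_ : 1 - 2^-1 = 2^-1 :> R) ?divff ?invr_neq0//; lra.
by apply: cvg_geometric_series; rewrite ger0_norm; lra.
Qed.

Let half_cvg c : bounded01 c -> cvgn (series (fun p => c p * (2^-1) ^+ p.+1)).
Proof.
move=> c01; apply: (@series_le_cvg _ _ (fun p => (2^-1) ^+ p.+1)) => [p|p|p|].
- by have /andP[? _] := c01 p; rewrite mulr_ge0// ltW.
- exact: ltW.
- by have /andP[_ c1] := c01 p; rewrite ler_piMl// ltW.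
- by apply/cvg_ex; exists 1; exact: cvg_geo.
Qed.

Lemma half_sum_le c c' : bounded01 c -> bounded01 c' -> (forall p, c p <= c' p) ->
  half_sum c <= half_sum c'.
Proof.
move=> b b' cc'; apply: lim_series_le; [exact: half_cvg|exact: half_cvg|].
by move=> p; rewrite ler_pM2r.
Qed.

Lemma half_sum0 : half_sum (fun=> 0) = 0.
Proof.
rewrite /half_sum (_ : series _ = fun=> 0); first exact: lim_cst.
by apply/funext => n; rewrite /series /= big1// => p _; rewrite mul0r.
Qed.

Lemma half_sum_le1 c : bounded01 c -> half_sum c <= 1.
Proof.
move=> b; rewrite -(cvg_lim (@Rhausdorff R) cvg_geo).
apply: lim_series_le; [exact: half_cvg|by apply/cvg_ex; exists 1; exact: cvg_geo|].
by move=> p; have /andP[_ c1] := b p; rewrite ler_piMl// ltW.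
Qed.

(** The weights have total 1, so raising all coefficients by at most [e] raises the sum by at most
    [e]. *)
Lemma half_sum_leD c c' e : bounded01 c -> bounded01 c' -> (forall p, c' p <= c p + e) ->
  half_sum c' <= half_sum c + e.
Proof.
move=> b b' cc'.
have cvg_e : series (e *: (fun p => (2^-1) ^+ p.+1 : R)) @ \oo --> e.
  have -> : series (e *: (fun p => (2^-1) ^+ p.+1 : R)) =
      e *: series (fun p => (2^-1) ^+ p.+1 : R).
    exact: seriesZ.
  by rewrite -[X in _ --> X]mulr1; apply: cvgZr; exact: cvg_geo.
have ce : cvgn (series (e *: (fun p => (2^-1) ^+ p.+1 : R))).
  by apply/cvg_ex; exists e.
rewrite -[X in _ + X](cvg_lim (@Rhausdorff R) cvg_e) /half_sum.
rewrite -lim_seriesD//; last exact: half_cvg.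
apply: lim_series_le; [exact: half_cvg|apply: is_cvg_seriesD => //; exact: half_cvg|].
by move=> p /=; rewrite -mulrDl ler_pM2r.
Qed.

(** The difference is a series of nonnegative terms, bounded below by its partial sum through the
    positive term [q]. *)
Lemma half_sum_lt c c' q : bounded01 c -> bounded01 c' -> (forall p, c p <= c' p) ->
  c q < c' q -> half_sum c < half_sum c'.
Proof.
move=> b b' cc' cq; rewrite -subr_gt0 /half_sum -lim_seriesB; [|exact: half_cvg..].
set u := (X in series X).
have u0 p : 0 <= u p by rewrite /u /= -mulrBl mulr_ge0 ?subr_ge0// ltW.
have uq : 0 < u q by rewrite /u /= -mulrBl mulr_gt0 ?subr_gt0.
apply: (@lt_le_trans _ _ (series u q.+1)).
  rewrite /series /= big_nat_recr//= ltr_wpDl// sumr_ge0//.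
apply: nondecreasing_cvgn_le; last by apply: is_cvg_seriesB; exact: half_cvg.
by apply: nondecreasing_series => n _ _; exact: u0.
Qed.

End half_series.

(** * A monotone function with the same fibres as a path *)

Section parametrization.
Context (R : realType) (X : topologicalType) (d : X -> X -> R).
Hypothesis dM : metric_for R X d.
Context (h : R -> X).
Hypotheses (ch : continuous h) (h_neg : forall t, t <= 0 -> h t = h 0)
  (h_fib : forall s t u, s <= u <= t -> h s = h t -> h u = h s)
  (h_moves : forall t, exists2 t', t <= t' & h t' <> h t).

Let d0 x y : 0 <= d x y. Proof. by case: dM. Qed.

(* Points [z p] run through a dense subset of the image of [h]. The distance from
   [z p] to the part of the path up to time [t] decreases with [t], and when
   [h] reaches a new point it drops strictly for some [p]. *)
Let dist z t := inf [set d z (h u) | u in [set u | u <= t]].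

Let dist_lb z t : has_lbound [set d z (h u) | u in [set u | u <= t]].
Proof. by exists 0 => _ [u _ <-]. Qed.

Let dist_ne z t : [set d z (h u) | u in [set u | u <= t]] !=set0.
Proof. by exists (d z (h t)), t => /=. Qed.

Let dist_le z t u : u <= t -> dist z t <= d z (h u).
Proof. by move=> ut; apply: ge_inf; [exact: dist_lb|exists u]. Qed.

Let le_dist z t a : (forall u, u <= t -> a <= d z (h u)) -> a <= dist z t.
Proof. by move=> H; apply: lb_le_inf; [exact: dist_ne|move=> _ [u /= ut <-]; exact: H]. Qed.

Let dist_ge0 z t : 0 <= dist z t. Proof. exact: le_dist. Qed.

Let dist_mono z s t : s <= t -> dist z t <= dist z s.
Proof. by move=> st; apply: le_dist => u us; apply: dist_le; exact: le_trans st. Qed.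

Let dist_leD z s t e : s <= t -> (forall u, s <= u <= t -> d (h u) (h s) <= e) ->
  dist z s <= dist z t + e.
Proof.
move=> st he; rewrite -lerBlDr; apply: le_dist => u ut; rewrite lerBlDr.
have e0 : 0 <= e by apply: le_trans (he s _) => //; rewrite lexx.
have [us|/ltW su] := leP u s.
  by rewrite (le_trans (dist_le z s u us))// lerDl.
rewrite (le_trans (dist_le z s s (lexx s)))//.
rewrite (le_trans (metric_triangle _ _ _ dM (h u) _ _))// lerD2l he//.
by rewrite su.
Qed.

Let dist_neg z t : t <= 0 -> dist z t = dist z 0.
Proof.
move=> t0; apply/eqP; rewrite eq_le; apply/andP; split; last exact: dist_mono.
apply: le_dist => u u0; rewrite h_neg// -(h_neg t t0); exact: dist_le.
Qed.

(** The values of [h] at the rationals; a number that codes no rational yields [h 0]. *)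
Let z p := h (ratr (odflt (0 : rat) (unpickle p))).

Let z_dense t e : 0 < e -> exists p, d (z p) (h t) < e.
Proof.
move=> e0.
have [a /= a0 aP] : \forall u \near t, d (h t) (h u) < e.
  exact: (ch t _ (metric_nbhs _ _ _ dM (h t) _ e0)).
have lt_t : t - a < t by rewrite ltrBlDr ltrDl.
have [q /itvP qa] := rat_in_itvoo lt_t.
exists (pickle q); rewrite /z pickleK /= (metric_sym _ _ _ dM).
by apply: aP; rewrite /= ger0_norm ?subr_ge0 ?qa// ltrBlDr -ltrBlDl qa.
Qed.

(** The drop in distance since time 0, scaled into [[0, 1]]. The denominator is at least 1, so
    scaling does not enlarge differences. *)
Let c t p := (dist (z p) 0 - dist (z p) t) / (1 + dist (z p) 0).

Let den0 p : 0 < 1 + dist (z p) 0. Proof. by rewrite ltr_wpDr. Qed.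

Let c01 t p : 0 <= c t p <= 1.
Proof.
rewrite /c ler_pdivlMr// ler_pdivrMr// mul0r mul1r subr_ge0.
have -> /= : dist (z p) t <= dist (z p) 0.
  by have [t0|/ltW t0] := leP t 0; [rewrite dist_neg|exact: dist_mono].
have := dist_ge0 (z p) t; lra.
Qed.

Let phi t := half_sum R (c t).

Let c_mono s t p : s <= t -> c s p <= c t p.
Proof. by move=> st; rewrite /c ler_pM2r ?invr_gt0// lerB// dist_mono. Qed.

Let phi_mono s t : s <= t -> phi s <= phi t.
Proof. by move=> st; apply: half_sum_le => // p; exact: c_mono. Qed.

Let phi_leD s t e : s <= t -> (forall u, s <= u <= t -> d (h u) (h s) <= e) ->
  phi t <= phi s + e.
Proof.
move=> st he; apply: half_sum_leD => // p.
have e0 : 0 <= e by apply: le_trans (he s _) => //; rewrite lexx.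
rewrite -lerBlDl /c -mulrBl ler_pdivrMr//.
have := dist_leD (z p) s t e st he; have := dist_ge0 (z p) 0; nra.
Qed.

Let phi_continuous : continuous phi.
Proof.
move=> t; apply/cvgrPdist_le => e e0.
have [a /= a0 aP] : \forall u \near t, d (h t) (h u) < e / 2.
  exact: (ch t _ (metric_nbhs _ _ _ dM (h t) _ (divr_gt0 e0 (ltr0Sn _ 1)))).
have close u v : `|t - u| < a -> `|t - v| < a -> d (h u) (h v) <= e.
  move=> /aP/= tu /aP/= tv; have := metric_triangle _ _ _ dM (h t) (h u) (h v).
  by rewrite (metric_sym _ _ _ dM (h u) (h t)); lra.
exists a => // s /= ts; have [st|/ltW st] := leP s t.
  rewrite ger0_norm ?subr_ge0// in ts.
  rewrite ger0_norm ?subr_ge0 ?phi_mono// lerBlDl; apply: phi_leD => // u /andP[su ut].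
  by apply: close; rewrite ger0_norm ?subr_ge0//; lra.
rewrite ler0_norm ?subr_le0// in ts.
rewrite ler0_norm ?subr_le0 ?phi_mono// opprB lerBlDl; apply: phi_leD => // u /andP[su ut].
by apply: close; rewrite ler0_norm ?subr_le0//; lra.
Qed.

Let phi_const s t : s <= t -> h s = h t -> phi s = phi t.
Proof.
move=> st hst; apply/eqP; rewrite eq_le phi_mono//= -[leRHS]addr0.
by apply: phi_leD => // u su; rewrite (h_fib s t u) // (metric_id _ _ _ dM).
Qed.

(** The path up to time [s] keeps a distance [e > 0] from [h t]: [h] is constant before 0, so a
    minimum is attained on a segment, and it is nonzero by [h_fib]. A point [z p] within [e / 2] of
    [h t] then witnesses a strict drop. *)
Let phi_lt s t : s <= t -> h s <> h t -> phi s < phi t.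
Proof.
move=> st hst.
have cdist : continuous (fun u => d (h t) (h u)).
  move=> u; apply/cvgrPdist_lt => e e0.
  near=> v; have huv : d (h u) (h v) < e.
    by near: v; exact: (ch u _ (metric_nbhs _ _ _ dM (h u) _ e0)).
  have := metric_triangle _ _ _ dM (h u) (h t) (h v).
  have := metric_triangle _ _ _ dM (h v) (h t) (h u).
  by rewrite (metric_sym _ _ _ dM (h v) (h u)) ltr_norml; lra.
pose a := Num.min 0 s; have [e e0 he] : exists2 e, 0 < e &
    forall u, u <= s -> e <= d (h t) (h u).
  have le_as : a <= s by rewrite ge_min lexx orbT.
  have [v /itvP va vP] := EVT_min le_as (continuous_subspaceT cdist).
  exists (d (h t) (h v)).
    rewrite lt_neqAle d0 andbT eq_sym; apply/eqP => /(metric_eq _ _ _ dM) tv.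
    by apply: hst; rewrite (h_fib v t s)// ?va.
  move=> u us; have [au|/ltW ua] := leP a u; first by apply: vP; rewrite in_itv/= au.
  have -> : h u = h a.
    rewrite h_neg ?(le_trans ua) ?ge_min ?lexx// [in RHS]h_neg// ge_min lexx//.
  by apply: vP; rewrite in_itv/= lexx.
have [p zp] := z_dense t (e / 2) (divr_gt0 e0 (ltr0Sn _ 1)).
apply: (@half_sum_lt _ _ _ p) => //; first by move=> q; exact: c_mono.
rewrite /c ltr_pM2r ?invr_gt0// ltrD2l ltrN2.
apply: (le_lt_trans (dist_le (z p) t t (lexx t))).
apply: (lt_le_trans zp); apply: le_dist => u us.
have := metric_triangle _ _ _ dM (z p) (h t) (h u).
rewrite (metric_sym _ _ _ dM (h t) (z p)); have := he u us; lra.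
Unshelve. all: by end_near. Qed.

Let L := sup (range phi).

Let phi_ltL t : phi t < L.
Proof.
have [t' tt' ht] := h_moves t.
apply: (@lt_le_trans _ _ (phi t')); first by apply: phi_lt => // E; exact: ht.
apply: ub_le_sup; last by exists t'.
by exists 1 => _ [u _ <-]; exact: half_sum_le1.
Qed.

(* The supremum [L] of [phi] is not attained, so [phi / (L - phi)] is unbounded. *)
Lemma parametrization : exists psi : R -> R, [/\ continuous psi,
  {homo psi : s t / s <= t}, psi 0 = 0, forall y, exists t, y < psi t &
  forall s t, psi s = psi t <-> h s = h t].
Proof.
have phi0 : phi 0 = 0.
  rewrite /phi (_ : c 0 = fun=> 0) ?half_sum0//.
  by apply/funext => p; rewrite /c subrr mul0r.
have phi_ge0 t : 0 <= phi t.
  by rewrite -(half_sum0 R); apply: half_sum_le => // p; rewrite ?lexx ?ler01//; have /andP[] := c01 t p.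
have den t : 0 < L - phi t by rewrite subr_gt0.
exists (fun t => phi t / (L - phi t)); split.
- move=> t; apply: cvgM; first exact: phi_continuous.
  apply: cvgV; first by rewrite gt_eqF.
  by apply: cvgB; [exact: cvg_cst|exact: phi_continuous].
- move=> s t /phi_mono st; rewrite ler_pdivlMr// mulrAC ler_pdivrMr//.
  have := phi_ge0 s; have := phi_ltL t; nra.
- by rewrite phi0 mul0r.
- move=> y; pose y' := Num.max y 0; have L0 : 0 < L by rewrite -phi0.
  have y'0 : 0 <= y' by rewrite le_max lexx orbT.
  (* [y' / (1 + y') * L] is the value of [phi] at which [phi / (L - phi)] equals [y']. *)
  have [||_ [t _ <-] lt] := @sup_gt _ (range phi) (y' / (1 + y') * L).
  - by exists (phi 0), 0.
  - by rewrite -/L -[ltRHS]mul1r ltr_pM2r// ltr_pdivrMr; lra.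
  exists t; apply: (@le_lt_trans _ _ y'); first by rewrite le_max lexx.
  rewrite ltr_pdivlMr//; move: lt; rewrite mulrAC ltr_pdivrMr; lra.
- have key s t : s <= t -> phi s / (L - phi s) = phi t / (L - phi t) <-> h s = h t.
    move=> st; split => [E|/(phi_const s t st)->//].
    apply: contrapT => /(phi_lt s t st) lt; move/eqP: E.
    rewrite eqr_div ?lt0r_neq0// => /eqP; have := phi_ltL t; have := phi_ge0 s; nra.
  move=> s t; have [/key//|/ltW/key H] := leP s t.
  by split => /esym/H/esym.
Qed.

End parametrization.

(** * Proper injections are embeddings *)

Lemma proper_closed_map (Y X : topologicalType) (f : Y -> X) (F : set Y) :
  hausdorff_space X -> locally_compact [set: X] -> proper_map f -> closed F ->
  closed (f @` F).
Proof.
move=> hX lkX [cf pf] cF x clx; have [C + [cC clC]] := lkX x I.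
rewrite withinET => nC.
have cI : compact (f @` (f @^-1` C `&` F)).
  apply: continuous_compact; first exact: continuous_subspaceT.
  by apply: compact_closedI => //; exact: pf.
suff [y [_ Fy] <-] : (f @` (f @^-1` C `&` F)) x by exists y.
apply: (compact_closed hX cI) => N nN.
have [_ [[y Fy <-] [Cy Ny]]] := clx _ (filterI nC nN).
by exists (f y); split => //; exists y.
Qed.

Lemma proper_embedding (Y X : topologicalType) (f : Y -> X) :
  hausdorff_space X -> locally_compact [set: X] -> proper_map f -> injective f ->
  embedding f.
Proof.
move=> hX lkX pf fI; split => //; first by case: pf.
move=> U oU; exists (~` (f @` (~` U))).
  by rewrite openC; apply: proper_closed_map => //; rewrite closedC.
apply/seteqP; split => [_ [y Uy <-]|_ [[y _ <-] nU]].
  by split; [exists y|move=> [z nUz /fI E]; apply: nUz; rewrite E].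
by exists y => //; apply: contrapT => nUy; apply: nU; exists y.
Qed.

(** * Factoring a path through the half line *)

Section half_line.
Context (R : realType).

Let v (x : half_line R) : R := set_val x.

Let v_ge0 x : 0 <= v x.
Proof. by have := set_valP x; rewrite /= in_itv/= andbT. Qed.

Let v_inj : injective v. Proof. exact: val_inj. Qed.

Let v_continuous : continuous v. Proof. exact: initial_continuous. Qed.

(** The retraction sending negative reals to 0, total and continuous on the line. *)
Definition to_half_line (t : R) : half_line R.
Proof.
exists (Num.max t 0); apply/mem_set.
by rewrite /= in_itv/= andbT le_max lexx orbT.
Defined.

Let to_half_lineK t : 0 <= t -> v (to_half_line t) = t.
Proof. by move=> t0; rewrite /v set_valE /=; apply/max_idPl. Qed.

Let to_half_line_continuous : continuous to_half_line.
Proof.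
apply: continuous_comp_initial => t.
have -> : set_val \o to_half_line = (fun x : R => Num.max x 0).
  by apply/funext => x; rewrite /= set_valE.
by apply: continuous_max; [exact: cvg_id|exact: cvg_cst].
Qed.

Context (X : topologicalType) (h : R -> X) (psi : R -> R).
Hypotheses (hX : hausdorff_space X) (ch : continuous h)
  (h_proper : forall C, compact C -> exists M, forall t, M <= t -> ~ C (h t))
  (cpsi : continuous psi) (psi_mono : {homo psi : s t / s <= t}) (psi0 : psi 0 = 0)
  (psi_unbounded : forall y, exists t, y < psi t)
  (psi_fib : forall s t, psi s = psi t <-> h s = h t).

(** [r] is [h] after a section [th] of [psi]. No continuity of [th] is available; instead the
    preimage of a closed [A] corresponds to the [psi]-image of the times in [H A], which is closed
    because only a bounded range of times matters near any given value. *)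
Lemma half_line_factor : exists r : half_line R -> X, [/\ proper_map r, injective r &
  forall M, exists C, [/\ compact C, closed C &
    forall x, ~ C x -> exists2 t, M <= t & r x = h t]].
Proof.
have /choice[th thP] : forall y, exists t, 0 <= y -> 0 <= t /\ psi t = y.
  move=> y; have [y0|] := boolP (0 <= y); last by exists 0.
  have [T yT] := psi_unbounded y.
  have T0 : 0 <= T.
    by rewrite leNgt; apply/negP => /ltW/psi_mono; rewrite psi0; lra.
  have [|t /itvP tT <-] := @IVT R psi 0 T y T0 (continuous_subspaceT cpsi).
    by rewrite psi0 ge_min y0/= le_max (ltW yT) orbT.
  by exists t => _; rewrite tT.
have psi_ge0 t : 0 <= t -> 0 <= psi t by move/psi_mono; rewrite psi0.
pose r (x : half_line R) := h (th (v x)).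
have thv x : 0 <= th (v x) /\ psi (th (v x)) = v x by exact: thP.
have rE x t : psi t = v x -> r x = h t.
  by move=> E; apply/psi_fib; rewrite (thv x).2.
pose H A := h @^-1` A `&` [set t | 0 <= t].
have preE A : r @^-1` A = v @^-1` (psi @` H A).
  apply/seteqP; split => [x Ax|x [t [At t0] tx]].
    by exists (th (v x)); have [] := thv x.
  by rewrite /preimage/= (rE x t).
have clH A : closed A -> closed (H A).
  move=> clA; apply: closedI; first by apply: preimage_closed => // x _; exact: ch.
  exact: closed_ge.
have cont : continuous r.
  apply/continuous_closedP => A clA; rewrite preE.
  apply: preimage_closed; first by move=> x _; exact: v_continuous.
  move=> y cly; have [T yT] := psi_unbounded y.
  have cI : compact (psi @` (`[0, T] `&` H A)).
    apply: continuous_compact; first exact: continuous_subspaceT.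
    by apply: compact_closedI; [exact: segment_compact|exact: clH].
  suff [t [_ Ht] <-] : (psi @` (`[0, T] `&` H A)) y by exists t.
  apply: (compact_closed (@Rhausdorff R) cI) => N nN.
  have [_ [[t Ht <-] [Nt tT]]] := cly _ (filterI nN (lt_nbhsl yT)).
  exists (psi t); split => //; exists t => //; split => //.
  rewrite /= in_itv/= Ht.2/= leNgt; apply/negP => /ltW/psi_mono.
  by rewrite leNgt tT.
exists r; split.
- split => // C cC; have [M hM] := h_proper C cC.
  (* The path avoids [C] from time [M] on, so the preimage is the image of a compact set of
     times. *)
  have -> : r @^-1` C = (to_half_line \o psi) @` (`[0, M] `&` h @^-1` C).
    rewrite preE; apply/seteqP; split => [x [t [Ct t0] tx]|_ [t [+ Ct] <-]].
      exists t; last by apply: v_inj; rewrite /= tx to_half_lineK.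
      split => //; rewrite /= in_itv/= t0/= leNgt; apply/negP => /ltW/hM.
      exact.
    rewrite /= in_itv/= => /andP[t0 _]; exists t => //.
    by rewrite to_half_lineK// psi_ge0.
  apply: continuous_compact.
    apply: continuous_subspaceT => t; apply: continuous_comp; first exact: cpsi.
    exact: to_half_line_continuous.
  apply: compact_closedI; first exact: segment_compact.
  apply: preimage_closed; first by move=> x _; exact: ch.
  exact: compact_closed.
- move=> x y /psi_fib; rewrite (thv x).2 (thv y).2; exact: v_inj.
- move=> M; exists (v @^-1` [set t | t <= psi M]); split.
  + have -> : v @^-1` [set t | t <= psi M] = to_half_line @` `[0, psi M].
      apply/seteqP; split => [x /= xM|_ [t /= + <-]].
        exists (v x); first by rewrite /= in_itv/= v_ge0.
        by apply: v_inj; rewrite to_half_lineK.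
      by rewrite in_itv/= => /andP[t0 tM]; rewrite to_half_lineK.
    apply: continuous_compact; last exact: segment_compact.
    by apply: continuous_subspaceT; exact: to_half_line_continuous.
  + apply: preimage_closed; first by move=> x _; exact: v_continuous.
    exact: closed_le.
  + move=> x /negP; rewrite -ltNge => Mx; exists (th (v x)) => //.
    rewrite leNgt; apply/negP => /ltW/psi_mono; rewrite (thv x).2; lra.
Qed.

End half_line.

(** * The ray pointing to a given end *)

Section ray.
Context (R : realType) (X : topologicalType) (d : X -> X -> R).
Hypothesis dM : metric_for R X d.
Context (K e : nat -> set X).
Hypotheses (gcX : generalized_continuum X) (exhK : compact_exhaustion K) (eK : ends K e).

Let e_le m n : (m <= n)%N -> e n `<=` e m.
Proof.
case: eK => eS _ /subnK <-; elim: (n - m)%N => // k IH.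
by rewrite addSn => x /eS /IH.
Qed.

Let e_component n : components (~` K n) (e n).
Proof. by case: eK => _ /(_ n)[]. Qed.

Let eNK n x : e n x -> ~ K n x.
Proof. by case: (e_component n) => y _ <- /connected_component_sub. Qed.

Lemma path_into_end : exists f : R -> X, continuous f /\ forall n t, n%:R <= t -> e n (f t).
Proof.
have /choice[x xe] : forall n, exists x, e n x.
  move=> n; have [y Ky <-] := e_component n; exists y.
  exact: connected_component_refl.
have oe n : open (e n).
  by have [y Ky <-] := e_component n; exact: exhaustion_component_open.
have ce n : connected (e n).
  by have [y Ky <-] := e_component n; exact: component_connected.
have /choice[c cP] : forall n, exists c : R -> X, [/\ continuous c,
    forall t, t <= 0 -> c t = x n, forall t, 1 <= t -> c t = x n.+1 &
    forall t, e n (c t)].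
  move=> n; apply: (path_exists _ _ d dM) => //.
  - exact: gc_locally_connected.
  - exact: gc_locally_compact.
  - exact: e_le (leqnSn n) _ (xe _).
exists (fun t => c (Num.truncn t) (t - (Num.truncn t)%:R)); split.
  by apply: (concatenation_continuous R X c x) => n t; have [+ + +] := cP n; auto.
move=> n t nt; have [_ _ _ et] := cP (Num.truncn t).
apply: (e_le n (Num.truncn t)); last exact: et.
by rewrite truncn_ge_nat// (le_trans _ nt).
Qed.

(** The compact set lies in some [K i], and from time [i] on the path stays in [e i], off [K i]. *)
Let avoids (f : R -> X) (C : set X) : (forall n t, n%:R <= t -> e n (f t)) ->
  compact C -> exists M, forall t, M <= t -> ~ C (f t).
Proof.
move=> fe /(compact_sub_exhaustion _ _ exhK)[i Ci]; exists i%:R => t /fe /eNK nK.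
by move=> /Ci.
Qed.

Lemma ray_to_end : exists r : half_line R -> X,
  [/\ proper_map r, embedding r & points_to K r e].
Proof.
have hX := gc_hausdorff gcX.
have [f [cf fe]] := path_into_end.
have f_proper M : exists M', forall s t, 0 <= s <= M -> M' <= t -> f s <> f t.
  have cC : compact (f @` `[0, M]).
    by apply: continuous_compact; [exact: continuous_subspaceT|exact: segment_compact].
  have [M' hM'] := avoids f _ fe cC; exists M' => s t sM /hM' nt st; apply: nt.
  by exists s.
have [g [cg g_fib gf]] := loop_erasure _ _ _ dM f cf f_proper.
(* Fibres of [g] are controlled only at nonnegative times; making the path constant before 0 extends
   this to the whole line. *)
pose h (t : R) := g (Num.max t 0).
have he n t : n%:R <= t -> e n (h t).
  move=> nt; rewrite /h (max_idPl _); last exact: le_trans nt.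
  by have [u tu ->] := gf t; apply: fe; exact: le_trans tu.
have ch : continuous h.
  move=> t; apply: continuous_comp; last exact: cg.
  by apply: continuous_max; [exact: cvg_id|exact: cvg_cst].
have h_neg t : t <= 0 -> h t = h 0.
  by move=> t0; rewrite /h (max_idPr t0) maxxx.
have h_fib s t u : s <= u <= t -> h s = h t -> h u = h s.
  move=> /andP[su ut]; apply: g_fib; first by rewrite le_max lexx orbT.
  by rewrite !ge_max !le_max su ut lexx !orbT.
have h_moves t : exists2 t', t <= t' & h t' <> h t.
  have [M hM] := avoids h _ he (@compact_set1 _ (h t)).
  exists (Num.max t M); first by rewrite le_max lexx.
  by apply: hM; rewrite le_max lexx orbT.
have [psi [cpsi psi_mono psi0 psi_unb psi_fib]] :=
  parametrization _ _ _ dM h ch h_neg h_fib h_moves.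
have [r [pr ri rtail]] := half_line_factor R X h psi hX ch
  (fun C => avoids h C he) cpsi psi_mono psi0 psi_unb psi_fib.
exists r; split => //.
  by apply: proper_embedding => //; exact: gc_locally_compact.
have EU : ends (fun i => r @^-1` K i) (half_line_end (fun i => r @^-1` K i)).
  by rewrite (ends_half_line (preimage_exhaustion pr exhK)).
(* The [i]-th set of the half line's end is unbounded, so it has a point outside the compact [C].
   Its image lies in [e i] and in the component given by [ends_map]; components sharing a point
   coincide. *)
apply/funext => i.
have [[y Ky yE] rU] := ends_mapP pr.1 EU i.
have [C [cC clC hC]] := rtail i%:R.
have [x [Ux nCx]] : exists x, half_line_end (fun i => r @^-1` K i) i x /\ ~ C x.
  apply: contrapT => nx; have [_ /(_ i)[_]] := EU; apply.
  apply: (subclosed_compact _ cC); first exact: closed_closure.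
  rewrite [X in _ `<=` X](closure_id C).1//; apply: closureS => x Ux.
  by apply: contrapT => nCx; apply: nx; exists x.
have rx : e i (r x) by have [t it ->] := hC x nCx; exact: he.
have rx' : ends_map r K (half_line_end (fun i => r @^-1` K i)) i (r x).
  by apply: rU; exists x.
have [z Kz zE] := e_component i.
move: rx rx'; rewrite -yE -zE => rx rx'; exact: component_meet rx' rx.
Qed.

End ray.

Theorem theorem5p4 (R : realType) (X : topologicalType)
    (gcX : generalized_continuum X) (metX : metrizable R X)
    (ncX : ~ compact [set: X])
    (K : nat -> set X) (exhK : compact_exhaustion K) :
  ends K !=set0 /\
  forall e : nat -> set X, ends K e ->
    exists r : half_line R -> X,
      [/\ proper_map r, embedding r & points_to K r e].
Proof.
split; first exact: ends_nonempty.
by have [d dM] := metX => e eK; exact: ray_to_end dM K e gcX exhK eK.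
Qed.
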